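(* Let $n\ge 1$ and let $D=\sum_{i=1}^n p_i(x)\partial_{x_i}$ be a simple derivation of $K[x]$, where $p_i(x)\in K[x]$ for all $1\le i\le n$. If $f\in\operatorname{Aut}(K[x])_D$ and $f-f(0)\in \operatorname{Aut}(K[x])_D$, then $f=x+f(0)$. In particular, $f$ is a translation.
   Context: $K$ is a field of characteristic zero, $K[x]=K[x_1,\ldots,x_n]$, and $\partial_{x_i}=\partial/\partial x_i$. A $K$-derivation $D$ of $K[x]$ is a $K$-linear map $K[x]\to K[x]$ with $D(ab)=D(a)b+aD(b)$. An ideal $I$ is $D$-stable if $D(I)\subset I$; $D$ is simple if the only $D$-stable ideals of $K[x]$ are $0$ and $K[x]$. A polynomial map $f=(f_1,\ldots,f_n)$, $f_i\in K[x]$, is called invertible if there is a polynomial map $h=(h_1,\ldots,h_n)$ with $x_i=h_i(f_1,\ldots,f_n)$ for all $i$. Invertible polynomial maps $f$ are identified with $K$-automorphisms $\rho$ of $K[x]$ via $\rho(g)=g(f_1,\ldots,f_n)$, i.e. $\rho(x_i)=f_i$. $\operatorname{Aut}(K[x])$ is the group of $K$-automorphisms of $K[x]$ and $\operatorname{Aut}(K[x])_D=\{\rho\in\operatorname{Aut}(K[x]) : \rho D=D\rho\}$. Write $f(0)=(f_1(0,\ldots,0),\ldots,f_n(0,\ldots,0))\in K^n$, $f-f(0)=(f_1-f_1(0),\ldots,f_n-f_n(0))$ and $x+f(0)=(x_1+f_1(0),\ldots,x_n+f_n(0))$. A translation is a map $x+c$ with $c\in K^n$. *)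

(* Defs.v *)
From mathcomp Require Import all_boot all_order all_algebra.
From mathcomp Require Export mpoly.

Set Implicit Arguments.
Unset Strict Implicit.
Unset Printing Implicit Defensive.

Import GRing.Theory.
Local Open Scope ring_scope.

Section Definitions.
Variables (K : fieldType) (n : nat).
Local Notation P := {mpoly K[n]}.
Implicit Types (D : P -> P) (f p : n.-tuple P).

Definition K_derivation D : Prop :=
  linear D /\ (forall a b, D (a * b) = D a * b + a * D b).

(* Ideals are Prop-valued: simplicity must range over all ideals, not only
   over those with a boolean membership test. *)
Definition is_ideal (I : P -> Prop) : Prop :=
  [/\ I 0, (forall a b, I a -> I b -> I (a + b)) & (forall a b, I b -> I (a * b))].

Definition stable_under D (I : P -> Prop) : Prop := forall a, I a -> I (D a).

Definition simple_derivation D : Prop :=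
  K_derivation D /\
  (forall I : P -> Prop, is_ideal I -> stable_under D I ->
     (forall a, I a <-> a = 0) \/ (forall a, I a)).

Definition derivation_of p : P -> P :=
  fun g => \sum_(i < n) tnth p i * g^`M(i).

Definition K_automorphism (rho : {lrmorphism P -> P}) : Prop := bijective rho.

Definition in_Aut_D D (rho : {lrmorphism P -> P}) : Prop :=
  K_automorphism rho /\ (forall g, rho (D g) = D (rho g)).

(* A polynomial map f is identified with the substitution g |-> g(f1, .., fn);
   lrmorphism_subst shows that every K-endomorphism arises this way. *)
Definition subst f : {lrmorphism P -> P} := comp_mpoly f.

Definition eval0 f : 'I_n -> K := fun i => (tnth f i).@[fun=> 0].

Definition translation (c : 'I_n -> K) : n.-tuple P :=
  [tuple 'X_i + (c i)%:MP | i < n].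

Definition sub_const f (c : 'I_n -> K) : n.-tuple P :=
  [tuple tnth f i - (c i)%:MP | i < n].

Lemma subst_X f i : subst f 'X_i = tnth f i.
Proof. by rewrite /= comp_mpolyXU -tnth_nth. Qed.

Lemma lrmorphism_subst (rho : {lrmorphism P -> P}) :
  rho =1 subst [tuple rho 'X_i | i < n].
Proof.
move=> g; rewrite /= comp_mpolyE {1}[g]mpolyE linear_sum /=.
apply: eq_bigr => m _; rewrite linearZ /= mpolyXE_id rmorph_prod /=.
by congr (_ *: _); apply: eq_bigr => i _; rewrite rmorphXn /= tnth_mktuple.
Qed.

Lemma subst_invertible f : K_automorphism (subst f) ->
  exists h : n.-tuple P, forall i, 'X_i = tnth h i \mPo f.
Proof.
case=> rho' _ fK; exists [tuple rho' 'X_i | i < n] => i.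
by rewrite tnth_mktuple; have /= -> := fK 'X_i.
Qed.

Lemma derivation_of_K_derivation p : K_derivation (derivation_of p).
Proof.
split=> [c a b | a b]; rewrite /derivation_of.
  rewrite scaler_sumr -big_split /=; apply: eq_bigr => i _.
  by rewrite linearP mulrDr scalerAr.
rewrite mulr_suml mulr_sumr -big_split /=; apply: eq_bigr => i _.
rewrite mderivM mulrDr; congr (_ + _); first by rewrite mulrA.
exact: mulrCA.
Qed.

End Definitions.

(* Main.v *)
Require Import Defs.
From mathcomp Require Import all_boot all_order all_algebra.

(** The theorem is a rigidity statement: an endomorphism [rho] that commutes
    with a simple derivation [D] and fixes a rational point is the identity.

    Let [J] be the ideal generated by all the differences [rho a - a].  Since
    [D (rho a - a) = rho (D a) - D a], the derivation maps generators to
    generators, so [J] is [D]-stable; by simplicity it is zero or everything.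
    If [rho] fixes the point [v], every generator vanishes at [v], hence so
    does every element of [J], and [J] cannot contain 1.  So [J = 0], which
    says that [rho] is the identity.

    The map [f - f(0)] fixes the origin by construction, so it is the identity
    as soon as it commutes with [D]; this reads [f = x + f(0)]. *)

Import GRing.Theory.

Local Open Scope ring_scope.

Section Ideals.
Variables (K : fieldType) (n : nat).
Local Notation P := {mpoly K[n]}.

Inductive generated_ideal (S : P -> Prop) : P -> Prop :=
| generated_ideal_in a : S a -> generated_ideal S a
| generated_ideal0 : generated_ideal S 0
| generated_idealD a b :
    generated_ideal S a -> generated_ideal S b -> generated_ideal S (a + b)
| generated_idealM a b : generated_ideal S b -> generated_ideal S (a * b).

Lemma generated_ideal_is_ideal (S : P -> Prop) : is_ideal (generated_ideal S).
Proof.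
split; first exact: generated_ideal0.
- exact: generated_idealD.
- exact: generated_idealM.
Qed.

Lemma generated_ideal_sub (S I : P -> Prop) :
  is_ideal I -> (forall a, S a -> I a) -> forall a, generated_ideal S a -> I a.
Proof.
case=> I0 ID IM SI a; elim=> {a} [a /SI // | // | a b _ Ia _ Ib | a b _ Ib].
- exact: ID.
- exact: IM.
Qed.

(** By the Leibniz rule, stability of an ideal can be tested on generators. *)
Lemma generated_ideal_stable (D : P -> P) (S : P -> Prop) :
  K_derivation D -> (forall a, S a -> generated_ideal S (D a)) ->
  stable_under D (generated_ideal S).
Proof.
case=> D_lin D_mul DS a; elim=> {a} [a /DS // | | a b _ Ja _ Jb | a b Jb JDb].
- have := D_mul 0 0; rewrite mulr0 !mul0r mulr0 addr0 => ->.
  exact: generated_ideal0.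
- by have := D_lin 1 a b; rewrite !scale1r => ->; apply: generated_idealD.
- rewrite D_mul; apply: generated_idealD; exact: generated_idealM.
Qed.

Lemma vanishing_is_ideal (v : 'I_n -> K) :
  is_ideal (fun a : P => a.@[v] = 0).
Proof.
split; first exact: meval0.
- by move=> a b a0 b0; rewrite mevalD a0 b0 addr0.
- by move=> a b b0; rewrite mevalM b0 mulr0.
Qed.

End Ideals.

Arguments generated_ideal {K n} S _.
Arguments generated_ideal_is_ideal {K n} S.

(** The ideal generated by the [rho a - a] is [D]-stable because [rho] commutes
    with [D], and proper because all its elements vanish at [v]. *)
Lemma simple_commuting_fixpoint_id (K : fieldType) (n : nat)
    (D : {mpoly K[n]} -> {mpoly K[n]})
    (rho : {additive {mpoly K[n]} -> {mpoly K[n]}}) (v : 'I_n -> K) :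
  simple_derivation D -> (forall a, rho (D a) = D (rho a)) ->
  (forall a, (rho a).@[v] = a.@[v]) -> forall a, rho a = a.
Proof.
case=> D_der D_simple rhoD rho_v a.
pose S b := exists c, b = rho c - c.
have J_stable : stable_under D (generated_ideal S).
  apply: generated_ideal_stable => // b [c ->].
  apply: generated_ideal_in; exists (D c).
  case: D_der => D_lin _; have := D_lin (-1) c (rho c).
  by rewrite !scaleN1r [- c + _]addrC => ->; rewrite rhoD addrC.
have J_vanish : forall b, generated_ideal S b -> b.@[v] = 0.
  apply: (generated_ideal_sub _ _ _ _ (vanishing_is_ideal _ _ v)) => b [c ->].
  by rewrite mevalB rho_v subrr.
have [J0 | JT] := D_simple _ (generated_ideal_is_ideal S) J_stable.
  apply/eqP; rewrite -subr_eq0; apply/eqP/J0.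
  by apply: generated_ideal_in; exists a.
by have /eqP := J_vanish 1 (JT 1); rewrite meval1 oner_eq0.
Qed.

Lemma subst_fixpoint_meval (K : fieldType) (n : nat)
    (g : n.-tuple {mpoly K[n]}) (v : 'I_n -> K) :
  (forall i, (tnth g i).@[v] = v i) ->
  forall a, (subst g a).@[v] = a.@[v].
Proof. by move=> gv a; rewrite /= comp_mpoly_meval; apply: meval_eq. Qed.

Theorem theorem2p1 (K : fieldType) (n : nat) (p f : n.-tuple {mpoly K[n]})
  (hK : [pchar K] =i pred0) (hn : (1 <= n)%N)
  (hD : simple_derivation (derivation_of p))
  (hf : in_Aut_D (derivation_of p) (subst f))
  (hf0 : in_Aut_D (derivation_of p) (subst (sub_const f (eval0 f)))) :
  f = translation (eval0 f) /\ (exists c : 'I_n -> K, f = translation c).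
Proof.
suff f_eq : f = translation (eval0 f) by split=> //; exists (eval0 f).
case: hf0 => _ g_comm.
pose g := sub_const f (eval0 f).
have g0 i : (tnth g i).@[fun=> 0] = 0 by rewrite tnth_mktuple mevalB mevalC subrr.
have g_id : forall a, subst g a = a.
  exact: simple_commuting_fixpoint_id hD g_comm (subst_fixpoint_meval _ _ _ _ g0).
apply: eq_from_tnth => i.
by rewrite tnth_mktuple -{1}['X_i]g_id subst_X tnth_mktuple subrK.
Qed.
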